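(* Let $(X,\triangleright)$ be a finite crossed set whose cardinality is divisible by at least two different primes. Then the following are equivalent. (1) $X$ is simple. (2) There exist a finite non-abelian simple group $L$, a positive integer $t$ and $x\in\mathrm{Aut}(L^t)$ acting by $$x\cdot(l_1,\dots,l_t)=(\theta(l_t),l_1,\dots,l_{t-1})$$ for some $\theta\in\mathrm{Aut}(L)$, such that $X$ is (isomorphic to) an orbit $\mathcal O_x(n)$ of some $n\in N=L^t$ under the action $\rightharpoonup_x$ of $N$ on itself given by $m\rightharpoonup_x n=m\,n\,x(m^{-1})$, where the rack operation on the orbit is $$m\triangleright p=m\,x(pm^{-1})\qquad (m,p\in \mathcal O_x(n));$$ here, in the case $t=1$ and $x$ inner, say $x(p)=mpm^{-1}$ for all $p\in L$, it is required that $n\ne m^{-1}$. Furthermore, in (2), $L$ (up to isomorphism) and $t$ are uniquely determined by $X$, and $x$ is determined exactly up to the conjugacy class of its image in $\mathrm{Out}(L^t)=\mathrm{Aut}(L^t)/\mathrm{Int}(L^t)$: another automorphism $x'\in\mathrm{Aut}(L^t)$ acting by $x'\cdot(l_1,\dots,l_t)=(\theta'(l_t),l_1,\dots,l_{t-1})$ for some $\theta'\in\mathrm{Aut}(L)$ can be used in (2) in place of $x$ (with a suitable $n'$ in place of $n$) if and only if $x$ and $x'$ have conjugate images in $\mathrm{Out}(L^t)$.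
   Context: A rack is a pair $(X,\triangleright)$ where $X$ is a non-empty set and $\triangleright:X\times X\to X$ is such that each $\phi_i(j)=i\triangleright j$ is a bijection of $X$ and $i\triangleright(j\triangleright k)=(i\triangleright j)\triangleright(i\triangleright k)$ for all $i,j,k$. A crossed set is a rack such that $i\triangleright i=i$ for all $i$, and $j\triangleright i=i$ whenever $i\triangleright j=j$. Morphisms are maps preserving $\triangleright$. A rack is trivial if $i\triangleright j=j$ for all $i,j$. A rack $X$ is simple if it is not trivial and, for every surjective rack morphism $\pi:X\to Y$, $\mathrm{card}\,Y$ is either $1$ or $\mathrm{card}\,X$. $\mathrm{Int}(N)$ denotes the group of inner automorphisms of a group $N$. *)

(* Defs.v *)
From HB Require Import structures.
From mathcomp Require Import all_boot all_fingroup all_solvable.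

Set Implicit Arguments.
Unset Strict Implicit.
Unset Printing Implicit Defensive.

Import GroupScope.

Section Racks.

Variables (X : Type) (op : X -> X -> X).

(* The carrier of a rack is non-empty by convention. *)
Record is_rack : Prop := IsRack {
  rack_nonempty : inhabited X;
  rack_bijective : forall i, bijective (op i);
  rack_selfdistr : forall i j k, op i (op j k) = op (op i j) (op i k) }.

Record is_crossed_set : Prop := IsCrossedSet {
  crossed_set_rack : is_rack;
  crossed_set_idem : forall i, op i i = i;
  crossed_set_sym : forall i j, op i j = j -> op j i = i }.

Definition is_trivial_rack : Prop := forall i j, op i j = j.

Definition rack_morphism (Y : Type) (opY : Y -> Y -> Y) (f : X -> Y) : Prop :=
  forall i j, f (op i j) = opY (f i) (f j).

End Racks.

(* Since X is finite, so is every surjective image of X; hence it is enough to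
   let the target Y range over finite types. *)
Definition is_simple_rack (X : finType) (op : X -> X -> X) : Prop :=
  [/\ is_rack op,
      ~ is_trivial_rack op &
      forall (Y : finType) (opY : Y -> Y -> Y) (f : X -> Y),
        is_rack opY -> rack_morphism op opY f -> (forall y, exists i, f i = y) ->
        #|Y| = 1%N \/ #|Y| = #|X|].

(* The direct power L^t, with its pointwise group structure. *)
Notation dpower L t := {dffun forall _ : 'I_t, L}.

(* x . (l_1, ..., l_t) = (theta l_t, l_1, ..., l_{t-1}), with indices starting
   at 0; ord_pred is the cyclic predecessor, so ord_pred 0 is t.-1. *)
Definition shift_by (L : finGroupType) (t : nat) (theta : {perm L})
    (x : {perm dpower L t}) : Prop :=
  forall (l : dpower L t) (i : 'I_t),
    x l i = if val i == 0%N then theta (l (ord_pred i)) else l (ord_pred i).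

Definition is_twisted_shift (L : finGroupType) (t : nat)
    (x : {perm dpower L t}) : Prop :=
  x \in Aut [set: dpower L t] /\
  exists2 theta : {perm L}, theta \in Aut [set: L] & shift_by theta x.

Section TwistedOrbits.

Variables (N : finGroupType) (x : {perm N}).

Definition twisted_act (m n : N) : N := m * n * x m^-1.

Definition twisted_orbit (n : N) : {set N} := [set twisted_act m n | m : N].

Definition twisted_op (m p : N) : N := m * x (p * m^-1).

(* An isomorphism from X onto the orbit of n is given as an injection into N
   whose image is that orbit. *)
Definition iso_twisted_orbit (X : finType) (op : X -> X -> X) (n : N) : Prop :=
  exists f : X -> N,
    [/\ injective f, [set f i | i : X] = twisted_orbit n
      & rack_morphism op twisted_op f].

Definition Int : {group {perm N}} := (conj_aut [set: N] @* [set: N])%G.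

Definition Out : {group coset_of Int} := (Aut [set: N] / Int)%G.

End TwistedOrbits.

Definition conj_in_Out (N : finGroupType) (x x' : {perm N}) : Prop :=
  coset (Int N) x' \in coset (Int N) x ^: Out N.

Record realizes (X : finType) (op : X -> X -> X) (L : finGroupType) (t : nat)
    (x : {perm dpower L t}) (n : dpower L t) : Prop := Realizes {
  realizes_simple : simple [set: L];
  realizes_nonabelian : ~~ abelian [set: L];
  realizes_gt0 : (0 < t)%N;
  realizes_shift : is_twisted_shift x;
  realizes_iso : iso_twisted_orbit x op n;
  (* Excludes the one-point orbit; here L^1 stands for L. *)
  realizes_neq : t = 1%N ->
    forall m : dpower L t, (forall p, x p = m * p * m^-1) -> n <> m^-1 }.

(* Main.v *)
Require Import Defs.
From HB Require Import structures.
From mathcomp Require Import all_boot all_fingroup all_solvable.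

Set Implicit Arguments.
Unset Strict Implicit.
Unset Printing Implicit Defensive.

Import GroupScope.

(** Attach to a rack X its inner group: the group G generated by the left
translations phi_i, which satisfy phi_(i > j) = phi_j ^ phi_i. Everything is
read off from G, its derived subgroup G' and the class of the phi_i.

A twisted orbit O of n in N is, through p |-> conj_p o x, a class of
automorphisms of N on which N acts transitively; in these terms the
phi_j^-1 * phi_i come from the action of elements of N, and phi_i induces on the
acting group N the automorphism conj_(p_i) o x, p_i being the point of index i. When N = L^t with L nonabelian simple
and x a twisted shift, N has no proper nontrivial normal subgroup stable under
x, because x moves one simple factor through all of them
([shift_no_stable_normal]). This forces N to act faithfully and its image to be
exactly G' ([twisted_perm_der]). Three consequences follow.
- The rack is simple ([twisted_realization_simple]): the elements of N that
  preserve the fibres of a quotient map form a normal x-stable subgroup, so the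
  quotient is either a point or injective.
- L^t is isomorphic to G', which depends on X only. A normal simple subgroup of
  L^t is isomorphic to L, by a coordinate projection, so G' determines L, and
  then t by counting ([dpower_isog_inj]).
- Two realizations on the same N give two isomorphisms of N onto G', hence an
  automorphism a of N comparing them; a carries conj_(p_i) o x to
  conj_(p'_i) o x', so x and x' have conjugate outer classes
  ([twisted_orbits_conj]). Conversely, such a conjugacy transports one orbit to
  an orbit of the other automorphism ([iso_twisted_orbit_conj]).

Now let X be simple. Applying simplicity to i |-> phi_i, to i |-> phi_i mod H
for a normal subgroup H of G, and to i |-> the G'-orbit of i shows that phi is
injective, that G' is the smallest nontrivial normal subgroup of G and is
transitive on X, and that G is generated by G' and any single y = phi_(i0).
If G' were abelian it would be a p-group and |X| a power of p, which is where
the two primes enter. So G' is a nonabelian minimal normal subgroup of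
G' <y>: it is the direct product of the conjugates of a minimal normal subgroup
S by the powers of y, and y acts on these factors as a twisted shift x
([minnormal_dpower]). Then i |-> phi_i^-1 * y identifies X with the twisted
orbit of 1 ([simple_rack_realized]). *)

(** * Automorphisms and inner automorphisms *)

Section Automorphisms.

Variables (N : finGroupType) (x : {perm N}).
Hypothesis Ax : x \in Aut [set: N].

Lemma AutM : {morph x : a b / a * b}.
Proof. by move=> a b; have:= morphM (autm_morphism Ax) (in_setT a) (in_setT b). Qed.

Lemma AutV : {morph x : a / a^-1}.
Proof. by move=> a; have:= morphV (autm_morphism Ax) (in_setT a). Qed.

End Automorphisms.

(** * Direct powers of a nonabelian simple group *)

Lemma center_simple_nonabelian (gT : finGroupType) (G : {group gT}) :
  simple G -> ~~ abelian G -> 'Z(G) = 1.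
Proof.
move=> /simpleP[_ simG]; apply: contraNeq => ntZ.
apply/center_idP; have [|] := simG _ (center_normal G) => //= Z1.
by rewrite Z1 eqxx in ntZ.
Qed.

Lemma noncommuting_partner (gT : finGroupType) (G : {group gT}) a :
  simple G -> ~~ abelian G -> a \in G -> a != 1 ->
  exists2 b, b \in G & [~ a, b] != 1.
Proof.
move=> simG nabG aG a1; apply/exists_inP; move: a1; apply: contraNT.
move=> /exists_inPn noG; apply/eqP/set1gP.
rewrite -(center_simple_nonabelian simG nabG); apply/centerP; split=> // b bG.
by apply/commgP; have := noG _ bG; rewrite negbK.
Qed.

(** For nontrivial N this says that N is minimal normal in its extension by x,
i.e. that N is simple among groups equipped with an automorphism. *)
Definition no_stable_normal (N : finGroupType) (x : {perm N}) : Prop :=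
  forall M : {group N}, M <| [set: N] ->
    (forall m, m \in M -> x m \in M) -> M :=: 1 \/ M :=: [set: N].

Section DirectPower.

Variables (L : finGroupType) (t : nat).
Hypotheses (simL : simple [set: L]) (nabL : ~~ abelian [set: L]).
Local Notation N := (dpower L t).
Local Notation at_ i := (@dfung1 _ (fun _ : 'I_t => L) i).

(** Some coordinate projection is nontrivial on K; it is injective there because
K is simple, and onto because its image is normal in L. *)
Lemma simple_normal_dpower (K : {group N}) :
  simple K -> K <| [set: N] -> K \isog [set: L].
Proof.
move=> /simpleP[ntK simK] nKN.
have [i [k kK ki]] : exists i, exists2 k, k \in K & k i != 1.
  have /trivgPn[k kK /eqP k1] := ntK.
  case: (pickP (fun i => k i != 1)) => [i ki|k0]; first by exists i, k.
  by case: k1; apply/ffunP => i; rewrite ffunE; apply/eqP/negbFE/k0.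
pose f : {morphism K >-> L} :=
  [morphism of restrm (subsetT K) (dffun_morphism (fun=> L) i)].
have injf : 'injm f.
  have [-> // | kerK] := simK _ (ker_normal f).
  have /mker/= : k \in 'ker f by rewrite kerK.
  by rewrite /restrm => k1; rewrite k1 eqxx in ki.
have imf : f @* K <| [set: L].
  rewrite /= im_restrm -[[set: L]](_ : dffun_morphism (fun=> L) i @* [set: N] = _).
    exact: morphim_normal.
  apply/setP=> s; rewrite inE; apply/morphimP.
  by exists (at_ i s); rewrite ?inE //= dfung1_id.
have [_ simL'] := simpleP _ simL; have [f1|fL] := simL' _ imf.
  have : k i \in f @* K by apply/morphimP; exists k.
  by rewrite f1 => /set1P/eqP; rewrite (negPf ki).
by rewrite -[X in _ \isog X]fL; apply: sub_isog.
Qed.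

Lemma dpower_prod (l : N) : l = \prod_i at_ i (l i).
Proof.
apply/ffunP => i; rewrite prodg_ffun (big_only1 i) ?dfung1_id//.
by move=> j ij _; rewrite dfung1_dflt.
Qed.

(** If l in M has l_i <> 1, commuting l with a suitable element of the i-th
factor gives a nontrivial element of M inside that factor, and simplicity of L
puts the whole factor in M. Applying x repeatedly reaches all the factors. *)
Lemma shift_no_stable_normal (theta : {perm L}) (x : {perm N}) :
  theta \in Aut [set: L] -> shift_by theta x -> no_stable_normal x.
Proof.
move=> Ath sx M nMN xM; have [M1|] := eqVneq (M : {set N}) 1; first by left.
case/trivgPn=> l lM l1; right.
pose D_ i : {morphism [set: L] >-> N} := dfung1_morphism (fun=> L) i.
have [i li] : exists i, l i != 1.
  case: (pickP (fun i => l i != 1)) => [i ki|k0]; first by exists i.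
  by case/eqP: l1; apply/ffunP => i; rewrite ffunE; apply/eqP/negbFE/k0.
have Di s : at_ i s \in M.
  have [b _ lb] := noncommuting_partner simL nabL (in_setT _) li.
  have cM : [~ l, at_ i b] \in M.
    by rewrite groupM ?groupV // memJ_norm // (subsetP (normal_norm nMN)) ?inE.
  have cE : [~ l, at_ i b] = at_ i [~ l i, b].
    apply/ffunP => j; rewrite /commg /conjg !mulg_ffun !invg_ffun.
    have [<-|nij] := eqVneq i j; first by rewrite !dfung1_id.
    by rewrite !dfung1_dflt // invg1 mul1g mulg1 mulVg.
  rewrite cE in cM.
  have nP : D_ i @*^-1 M <| [set: L].
    rewrite /normal subsetT /=.
    by have := morphpre_norms (D_ i) (normal_norm nMN); rewrite morphpreT.
  have [_ simL'] := simpleP _ simL; have [/= f1|/= fL] := simL' _ nP.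
    have : [~ l i, b] \in D_ i @*^-1 M by rewrite !inE.
    by rewrite f1 => /set1gP/eqP; rewrite (negPf lb).
  have : s \in D_ i @*^-1 M by rewrite /= fL inE.
  by rewrite !inE.
pose P i := forall s, at_ i s \in M.
have Pnext j : P j -> P (ordS j).
  move=> Pj s.
  have th1 : theta 1 = 1 by rewrite -(autmE Ath) morph1.
  (* theta is applied only when the shift wraps around to coordinate 0. *)
  pose s' := if val (ordS j) == 0%N then theta^-1%g s else s.
  suff -> : at_ (ordS j) s = x (at_ j s') by apply: xM.
  apply/ffunP => k; rewrite sx.
  have [<-|nk] := eqVneq (ordS j) k.
    by rewrite ordSK !dfung1_id /s'; case: (val _ == 0%N); rewrite ?permKV.
  have nk' : j != ord_pred k.
    by apply: contraNneq nk => ->; rewrite ord_predK.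
  by rewrite !dfung1_dflt // th1; case: ifP.
have Piter k : P (iter k (@ordS t) i) by elim: k => //= k; apply: Pnext.
have val_iter k : val (iter k (@ordS t) i) = ((i + k) %% t)%N.
  elim: k => [|k IH] /=; first by rewrite addn0 modn_small.
  by rewrite IH -addn1 modnDml addn1 addnS.
have Pall j : P j.
  (* t - i further steps wrap around from i to 0, and j more reach j. *)
  suff -> : j = iter (t - i + j) (@ordS t) i by apply: Piter.
  apply: val_inj; rewrite val_iter addnA subnKC; last exact/ltnW/ltn_ord.
  by rewrite modnDl modn_small.
apply/eqP; rewrite eqEsubset subsetT; apply/subsetP => n _.
by rewrite (dpower_prod n) group_prod // => j _; apply: Pall.
Qed.

Lemma dpower_nonabelian : (0 < t)%N -> ~~ abelian [set: N].
Proof.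
move=> t0; apply: contra nabL => abN; pose i := Ordinal t0.
apply/centsP=> a _ b _.
have /ffunP/(_ i) := centsP abN (at_ i a) (in_setT _) (at_ i b) (in_setT _).
by rewrite !mulg_ffun !dfung1_id.
Qed.

End DirectPower.

(** The image in L'^t' of one factor of L^t is a simple normal subgroup, hence a
copy of L'; the exponents then agree because the orders do. *)
Lemma dpower_isog_inj (L L' : finGroupType) t t' :
  simple [set: L] -> ~~ abelian [set: L] -> (0 < t)%N ->
  simple [set: L'] -> ~~ abelian [set: L'] ->
  [set: dpower L t] \isog [set: dpower L' t'] -> [set: L] \isog [set: L'] /\ t = t'.
Proof.
move=> simL nabL t0 simL' nabL' isoN; have /isogP[h injh imh] := isoN.
pose i := Ordinal t0; pose D_ := dfung1_morphism (fun _ : 'I_t => L) i.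
pose K := (h @* (D_ @* [set: L]))%G.
have isoK : [set: L] \isog K.
  apply: (isog_trans (sub_isog _ (injm_dfung1 (fun _ : 'I_t => L) i))) => //.
  by apply: sub_isog => //; apply: subsetT.
have nDi : D_ @* [set: L] <| [set: dpower L t].
  rewrite /normal subsetT; apply/subsetP => n _; rewrite inE.
  apply/subsetP=> _ /imsetP[_ /morphimP[s _ _ ->] ->].
  apply/morphimP; exists (s ^ n i); rewrite ?inE //=.
  apply/ffunP => j; rewrite /conjg !mulg_ffun !invg_ffun.
  have [<-|nij] := eqVneq i j; first by rewrite !dfung1_id.
  by rewrite !dfung1_dflt // mul1g mulVg.
have KL' : K \isog [set: L'].
  apply: (@simple_normal_dpower _ t') => //.
    by rewrite -(isog_simple isoK).
  by rewrite -imh morphim_normal.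
have LL' := isog_trans isoK KL'; split=> //.
have := card_isog isoN; have := card_isog LL'; rewrite !cardsT => LE.
have -> : #|dpower L t| = (#|L| ^ t)%N.
  by rewrite -[in RHS](card_ord t) -card_ffun.
have -> : #|dpower L' t'| = (#|L'| ^ t')%N.
  by rewrite -[in RHS](card_ord t') -card_ffun.
rewrite LE => /eqP; rewrite eqn_exp2l => [/eqP//|].
rewrite -LE ltnNge; apply: contra nabL => L1.
rewrite (_ : [set: L] = 1) ?abelian1 //.
by apply/eqP; rewrite trivg_card_le1 cardsT.
Qed.

Lemma shift_perm_exists (L : finGroupType) t (theta : {perm L}) :
  theta \in Aut [set: L] ->
  exists2 x : {perm dpower L t}, x \in Aut [set: dpower L t] & shift_by theta x.
Proof.
move=> Ath.
pose x0 (l : dpower L t) : dpower L t := [ffun i =>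
  if val i == 0%N then theta (l (ord_pred i)) else l (ord_pred i)].
have inj_x0 : injective x0.
  move=> l l' /ffunP ll'; apply/ffunP=> i; have := ll' (ordS i).
  by rewrite !ffunE !ordSK; case: ifP => // _ /perm_inj.
exists (perm inj_x0) => [|l i]; last by rewrite permE ffunE.
rewrite inE; apply/andP; split; first by apply/subsetP=> p; rewrite !inE.
apply/morphicP=> p q _ _; rewrite !permE; apply/ffunP=> i; rewrite !ffunE.
by case: ifP => // _; rewrite (AutM Ath).
Qed.

(** * Inner permutations of a rack *)

Section InnerPermutations.

Variables (X : finType) (op : X -> X -> X).
Hypothesis hR : is_rack op.

Definition rack_perm (i : X) : {perm X} := perm (bij_inj (rack_bijective hR i)).

Definition rack_inn : {group {perm X}} := <<[set rack_perm i | i : X]>>%G.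

Lemma rack_permE i j : rack_perm i j = op i j.
Proof. exact: permE. Qed.

Lemma mem_rack_inn i : rack_perm i \in rack_inn.
Proof. exact/mem_gen/imset_f. Qed.

(** Permutations compose from left to right here, so that conjugation by a rack
automorphism moves the index of a left translation forward. *)
Lemma rack_permJ (a : {perm X}) i :
  (forall j k, a (op j k) = op (a j) (a k)) -> rack_perm (a i) = rack_perm i ^ a.
Proof.
move=> aM; apply: (mulgI a); rewrite -conjgC.
by apply/permP=> j; rewrite !permM !rack_permE aM.
Qed.

Lemma rack_perm_op i j : rack_perm (op i j) = rack_perm j ^ rack_perm i.
Proof.
rewrite -(rack_permE i j) rack_permJ // => k l.
by rewrite !rack_permE (rack_selfdistr hR).
Qed.

Lemma rack_innP (H : {group {perm X}}) :
  (forall i, rack_perm i \in H) -> rack_inn \subset H.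
Proof.
by move=> phiH; rewrite gen_subG; apply/subsetP=> _ /imsetP[i _ ->].
Qed.

Definition fibre_stabilizer_set (Y : eqType) (k : X -> Y) :=
  [set g : {perm X} | [forall i, k (g i) == k i]].

Lemma fibre_stabilizer_group_set (Y : eqType) (k : X -> Y) :
  group_set (fibre_stabilizer_set k).
Proof.
apply/group_setP; split=> [|g h]; rewrite !inE.
  by apply/forallP => i; rewrite perm1.
move=> /forallP kg /forallP kh; apply/forallP=> i.
by rewrite permM (eqP (kh _)) kg.
Qed.

Definition fibre_stabilizer (Y : eqType) (k : X -> Y) : {group {perm X}} :=
  Group (fibre_stabilizer_group_set k).

Lemma fibre_stabilizerP (Y : eqType) (k : X -> Y) (g : {perm X}) :
  reflect (forall i, k (g i) = k i) (g \in fibre_stabilizer_set k).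
Proof. by rewrite inE; apply: (iffP forallP) => kg i; apply/eqP. Qed.

(** The fibres of a rack morphism are permuted by the left translations, so the
permutations that fix every fibre are normalized by them. *)
Lemma rack_inn_norm_fibre (Y : eqType) (opY : Y -> Y -> Y) (k : X -> Y) :
  rack_morphism op opY k -> rack_inn \subset 'N(fibre_stabilizer k).
Proof.
move=> kM; apply: rack_innP => i; rewrite inE.
apply/subsetP=> _ /imsetP[g /fibre_stabilizerP kg ->].
apply/fibre_stabilizerP=> j; rewrite -[j](permKV (rack_perm i)) -!permM.
by rewrite -conjgC !permM !rack_permE !kM kg.
Qed.

Lemma rack_inn_morphism g : g \in rack_inn ->
  forall j k, g (op j k) = op (g j) (g k).
Proof.
pose A := [set g : {perm X} | [forall j, forall k, g (op j k) == op (g j) (g k)]].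
have gA : group_set A.
  apply/group_setP; split=> [|u v]; rewrite !inE.
    by apply/'forall_forallP=> j k; rewrite !perm1.
  move=> /'forall_forallP uM /'forall_forallP vM.
  by apply/'forall_forallP=> j k; rewrite !permM (eqP (uM _ _)).
have /subsetP sGA : rack_inn \subset Group gA.
  apply: rack_innP => i; rewrite inE; apply/'forall_forallP=> j k.
  by rewrite !rack_permE (rack_selfdistr hR).
by move=> /sGA; rewrite inE => /'forall_forallP gM j k; apply/eqP/gM.
Qed.

(** Modulo H the inner group is generated by the single class of phi_i, so the
quotient is cyclic. *)
Lemma rack_inn_der_sub (H : {group {perm X}}) i :
  (forall k, rack_perm k \in 'N(H)) ->
  (forall k, (rack_perm i)^-1 * rack_perm k \in H) ->
  rack_inn^`(1) \subset H.
Proof.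
move=> nHphi HE; apply: der1_min; first exact: rack_innP.
have sG : rack_inn \subset <[rack_perm i]> <*> H.
  apply: rack_innP => k; rewrite -(mulKVg (rack_perm i) (rack_perm k)).
  apply: groupM; first by rewrite (subsetP (joing_subl _ _)) ?cycle_id.
  by rewrite (subsetP (joing_subr _ _)).
apply: abelianS (quotientS _ sG) _.
rewrite quotientYidr; last by rewrite cycle_subG; apply: nHphi.
exact: quotient_abelian (cycle_abelian _).
Qed.

End InnerPermutations.

(** * A twisted orbit and its inner permutations *)

Section TwistedRealization.

Variables (X : finType) (op : X -> X -> X) (hR : is_rack op).
Variables (N : finGroupType) (x : {perm N}) (n : N) (f : X -> N).
Hypotheses (Ax : x \in Aut [set: N]) (injf : injective f).
Hypotheses (imf : [set f i | i : X] = twisted_orbit x n).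
Hypotheses (fM : rack_morphism op (twisted_op x) f).

Local Notation phi := (rack_perm hR).

Fact twisted_move_subproof m i : exists k, f k == m^-1 * f i * x m.
Proof.
have /imsetP[u _ fu] : f i \in twisted_orbit x n by rewrite -imf imset_f.
have : m^-1 * f i * x m \in twisted_orbit x n.
  apply/imsetP; exists (m^-1 * u) => //.
  by rewrite fu /twisted_act !(AutV Ax, AutM Ax, invMg, invgK) !mulgA.
by rewrite -imf => /imsetP[k _ ->]; exists k.
Qed.

(** The action of m^-1 on the orbit, pulled back to X. The inverse turns a left
action into a morphism for the left-to-right product of permutations. *)
Definition twisted_move m i : X := xchoose (twisted_move_subproof m i).

Lemma twisted_moveE m i : f (twisted_move m i) = m^-1 * f i * x m.
Proof. exact/eqP/(xchooseP (twisted_move_subproof m i)). Qed.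

Lemma twisted_move_inj m : injective (twisted_move m).
Proof.
move=> i j /(congr1 f); rewrite !twisted_moveE.
by move/mulIg/mulgI/injf.
Qed.

Definition twisted_perm m : {perm X} := perm (@twisted_move_inj m).

Lemma twisted_permE m i : f (twisted_perm m i) = m^-1 * f i * x m.
Proof. by rewrite permE twisted_moveE. Qed.

Lemma twisted_permM : {in [set: N] &, {morph twisted_perm : a b / a * b}}.
Proof.
move=> a b _ _; apply/permP=> i; apply: injf.
by rewrite permM !twisted_permE (AutM Ax) invMg !mulgA.
Qed.
Canonical twisted_perm_morphism := Morphism twisted_permM.
Local Notation R := twisted_perm.

Lemma twisted_perm_trans i j : exists m, R m i = j.
Proof.
have /imsetP[u _ fu] : f i \in twisted_orbit x n by rewrite -imf imset_f.
have /imsetP[v _ fv] : f j \in twisted_orbit x n by rewrite -imf imset_f.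
exists (u * v^-1); apply: injf; rewrite twisted_permE fu fv /twisted_act.
by rewrite !(AutM Ax, AutV Ax, invMg, invgK) !mulgA !mulgKV.
Qed.

Lemma twisted_perm_rackJ m i : phi (R m i) = phi i ^ R m.
Proof.
apply: rack_permJ => j k; apply: injf; rewrite !(fM, twisted_permE).
by rewrite /twisted_op !(AutM Ax, AutV Ax, invMg, invgK) !mulgA !mulgK.
Qed.

(** Up to the action of N all left translations coincide: with y_i = conj_(f i) o x,
the automorphisms y_i and y_j differ by an inner automorphism. *)
Lemma rack_perm_twisted i j : phi i = phi j * R (f j * (f i)^-1).
Proof.
apply/permP=> k; apply: injf; rewrite permM twisted_permE !rack_permE.
rewrite !fM /twisted_op !(AutM Ax, AutV Ax, invMg, invgK) !mulgA.
by rewrite mulgKV mulgKV.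
Qed.

(** The translation phi_i normalizes the image of N and induces on it the
automorphism conj_(f i) o x. This recovers x up to inner automorphisms from the
permutation group alone, which is what makes its outer class an invariant. *)
Lemma twisted_permJ m i : R m ^ phi i = R (f i * x m * (f i)^-1).
Proof.
apply: (mulgI (phi i)); rewrite -conjgC; apply/permP=> k; apply: injf.
rewrite !permM twisted_permE !rack_permE !fM /twisted_op twisted_permE.
by rewrite !(AutM Ax, AutV Ax, invMg, invgK) !mulgA !mulgKV.
Qed.

Hypothesis gt1X : (1 < #|X|)%N.
Hypothesis nabN : ~~ abelian [set: N].
Hypothesis minN : no_stable_normal x.

Let X2 : exists i j : X, i != j.
Proof. by have /card_gt1P[i [j [_ _ ij]]] := gt1X; exists i, j. Qed.

(** The preimage of H is normal in N, and normality turns stability under conj_(f i) o x into stability under x. *)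
Lemma twisted_preim_normal (H : {group {perm X}}) :
  R @* [set: N] \subset 'N(H) -> (exists i, phi i \in 'N(H)) ->
  R @*^-1 H = 1 \/ R @*^-1 H = [set: N].
Proof.
move=> nHR [i nHphi].
have nM : R @*^-1 H <| [set: N].
  rewrite /normal subsetT; apply/subsetP=> u _; rewrite inE.
  apply/subsetP=> _ /imsetP[m mH ->]; move: mH; rewrite !inE /= => Rm.
  rewrite (morphJ twisted_perm_morphism) ?inE //= memJ_norm //.
  by rewrite (subsetP nHR) // (mem_morphim twisted_perm_morphism) ?inE.
apply: minN => //= m; rewrite !inE /= => Rm.
have: R (f i * x m * (f i)^-1) \in H by rewrite -twisted_permJ memJ_norm.
have E : R (x m) = R (f i * x m * (f i)^-1) ^ R (f i).
  by rewrite -morphJ ?inE // conjgE mulgKV mulKg.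
by rewrite E memJ_norm // (subsetP nHR) // mem_morphim ?inE.
Qed.

(** A trivially acting N would contradict transitivity on at least two points. *)
Lemma injm_twisted_perm : 'injm R.
Proof.
have [||/= K1|/= KT] := twisted_preim_normal (H := 1%G).
- by rewrite norm1 subsetT.
- by have [i _] := X2; exists i; rewrite norm1 inE.
- by rewrite /ker K1.
have [i [j]] := X2.
have [m <-] := twisted_perm_trans i j.
have : m \in R @*^-1 1 by rewrite KT inE.
by rewrite !inE /= => /eqP->; rewrite perm1 eqxx.
Qed.

(** For i <> j the element f j * (f i)^-1 is not 1 and acts as phi_j^-1 * phi_i, so
the preimage of the inner group is not trivial. *)
Lemma twisted_perm_sub_inn : R @* [set: N] \subset rack_inn hR.
Proof.
rewrite sub_morphim_pre //.
have nR : R @* [set: N] \subset 'N(rack_inn hR).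
  apply/subsetP=> _ /morphimP[m _ _ ->]; rewrite inE -genJ gen_subG.
  apply/subsetP=> _ /imsetP[_ /imsetP[i _ ->] ->].
  by rewrite -twisted_perm_rackJ mem_rack_inn.
have [i [j ij]] := X2.
have [||/= K1|/= ->//] := twisted_preim_normal (H := rack_inn hR) => //.
  by exists i; rewrite (subsetP (normG _)) // mem_rack_inn.
have : f j * (f i)^-1 \in R @*^-1 rack_inn hR.
  rewrite !inE /= -(mulKg (phi j) (R _)) -rack_perm_twisted.
  by rewrite groupM ?groupV // mem_rack_inn.
rewrite K1 => /set1gP/eqP; rewrite -eq_mulgV1 => /eqP/injf ji.
by rewrite ji eqxx in ij.
Qed.

(** Since the inner group is cyclic modulo the image of N, its derived subgroup
lies in that image. By irreducibility it is all of it or trivial, and in the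
latter case the inner group, hence N, would be abelian. *)
Lemma twisted_perm_der : (rack_inn hR)^`(1) = R @* [set: N].
Proof.
set G := rack_inn hR; have sRG := twisted_perm_sub_inn.
have [i [j ij]] := X2.
have nRphi k : phi k \in 'N(R @* [set: N]).
  rewrite inE; apply/subsetP=> _ /imsetP[_ /morphimP[m _ _ ->] ->].
  by rewrite twisted_permJ mem_morphim ?inE.
have derR : G^`(1) \subset R @* [set: N].
  apply: (rack_inn_der_sub (i := i)) => // k.
  by rewrite (rack_perm_twisted k i) mulKg mem_morphim ?inE.
apply/eqP; rewrite eqEsubset derR /= sub_morphim_pre //.
have nG' : G \subset 'N(G^`(1)) by apply/normal_norm/der_normal.
have [||/= K1|/= ->//] := twisted_preim_normal (H := (G^`(1))%G).
- exact: subset_trans nG'.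
- by exists i; rewrite (subsetP nG') // mem_rack_inn.
case/negP: nabN; rewrite -(injm_abelian injm_twisted_perm) //.
apply: abelianS sRG _; apply/derG1P.
by rewrite -(morphpreK derR) /= K1 morphim1.
Qed.

Lemma twisted_isog_der : [set: N] \isog (rack_inn hR)^`(1).
Proof. by rewrite twisted_perm_der sub_isog // injm_twisted_perm. Qed.

(** The elements of N that preserve every fibre of a quotient map k form 1 or N.
If N, then k is constant by transitivity. If 1, then k is injective: k i = k j
makes phi_j^-1 * phi_i preserve the fibres, which forces f i = f j. *)
Lemma twisted_realization_simple : is_simple_rack op.
Proof.
have [i0 _] := X2.
split=> // [triv|Y opY k _ kM surjk].
  case/negP: nabN; rewrite -(injm_abelian injm_twisted_perm) //.
  rewrite -twisted_perm_der; apply: abelianS (der_sub _ _) _.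
  apply: abelianS (abelian1 _); apply: rack_innP => i.
  by apply/set1gP/permP=> j; rewrite rack_permE triv perm1.
have nRk := rack_inn_norm_fibre hR kM.
have [||/= K1|/= KT] := twisted_preim_normal (H := fibre_stabilizer k).
- exact: subset_trans twisted_perm_sub_inn nRk.
- by exists i0; rewrite (subsetP nRk) // mem_rack_inn.
- right; have injk : injective k.
    move=> i j kij; apply: injf; apply/esym/eqP; rewrite eq_mulgV1.
    apply/eqP/set1gP; rewrite -K1; apply/morphpreP; split; first by rewrite inE.
    apply/fibre_stabilizerP=> l.
    rewrite -{1}[l](permKV (phi j)) -permM -rack_perm_twisted.
    rewrite -{2}[l](permKV (phi j)) !rack_permE !kM.
    by rewrite kij.
  rewrite -(card_codom injk); apply: eq_card => y; rewrite !inE.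
  by have [i <-] := surjk y; apply/esym/codom_f.
left; apply/eqP/fintype1P; exists (k i0) => y.
have [i <-] := surjk y; have [m <-] := twisted_perm_trans i0 i.
have : m \in R @*^-1 fibre_stabilizer k by rewrite KT inE.
by case/morphpreP=> _ /= /fibre_stabilizerP.
Qed.

End TwistedRealization.

(** * Outer classes of automorphisms *)

Section OuterClasses.

Variable N : finGroupType.
Local Notation c := (conj_aut [set: N]).

Lemma conj_autJ (a : {perm N}) u :
  a \in Aut [set: N] -> c u ^ a = c (a u).
Proof.
move=> Aa; apply: (mulgI a); rewrite -conjgC; apply/permP=> v.
by rewrite !permM !conj_autE ?inE // !conjgE !(AutM Aa) (AutV Aa).
Qed.

Lemma mem_Int u : c u \in Int N.
Proof. by apply: mem_morphim; rewrite ?(subsetP (normG _)) ?inE. Qed.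

Lemma Int_normAut : Aut [set: N] \subset 'N(Int N).
Proof.
apply/subsetP=> a Aa; rewrite inE.
apply/subsetP=> _ /imsetP[_ /morphimP[u _ _ ->] ->].
by rewrite (conj_autJ _ Aa) mem_Int.
Qed.

Lemma conj_in_OutP (x x' : {perm N}) :
  x \in Aut [set: N] -> x' \in Aut [set: N] ->
  (conj_in_Out x x' <->
   exists2 a, a \in Aut [set: N] & exists u, x' = c u * x ^ a).
Proof.
move=> Ax Ax'; have nI := subsetP Int_normAut; split.
  case/imsetP=> _ /morphimP[a nIa Aa ->]; rewrite /= -morphJ ?nI // => E.
  exists a => //.
  have [||_ /morphimP[u _ _ ->] ->] := kercoset_rcoset _ _ E.
  - exact: nI.
  - by rewrite nI ?groupJ.
  by exists u.
case=> a Aa [u E]; apply/imsetP.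
exists (coset (Int N) a); first by rewrite mem_morphim ?nI.
by rewrite -morphJ ?nI //= E coset_kerl ?mem_Int.
Qed.

(** If x' = a x a^-1 up to conjugation by u, the map i |-> a (f i) * x' u carries
conj_(f i) o x to its conjugate by a; the factor x' u absorbs the inner
automorphism by which x' and a x a^-1 differ. *)
Lemma iso_twisted_orbit_conj (X : finType) (op : X -> X -> X)
    (x x' : {perm N}) n :
  x \in Aut [set: N] -> x' \in Aut [set: N] -> conj_in_Out x x' ->
  iso_twisted_orbit x op n -> exists n', iso_twisted_orbit x' op n'.
Proof.
move=> Ax Ax' /conj_in_OutP[] // a Aa [u E] [f [injf imf fM]].
have ax p : a (x p) = x' u * x' (a p) * (x' u)^-1.
  rewrite -(AutV Ax') -!(AutM Ax') E permM conj_autE ?inE // conjgE.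
  by rewrite [_ ^ u]conjgE mulgKV mulKg !permM permK.
exists (a n * x' u); exists (fun i => a (f i) * x' u); split.
- by move=> i j /mulIg/perm_inj/injf.
- apply/setP=> p; apply/imsetP/imsetP=> [[i _ ->]|[m _ ->]].
    have /imsetP[m _ ->] : f i \in twisted_orbit x n by rewrite -imf imset_f.
    exists (a m) => //; rewrite /twisted_act !(AutM Aa) ax (AutV Aa).
    by rewrite !mulgA mulgKV.
  have : twisted_act x (a^-1%g m) n \in twisted_orbit x n by apply: imset_f.
  rewrite -imf => /imsetP[i _ fi]; exists i => //.
  rewrite -fi /twisted_act !(AutM Aa) ax (AutV Aa) permKV.
  by rewrite !mulgA mulgKV.
move=> i j; rewrite fM /twisted_op !(AutM Aa) ax invMg (AutM Aa) (AutV Aa).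
by rewrite !mulgA mulgKV mulgK.
Qed.

(** When x is conjugation by m, the point m^-1 is fixed by the twisted action, so
its orbit cannot carry a rack with two elements. *)
Lemma inner_twisted_orbit (X : finType) (op : X -> X -> X) (x : {perm N}) n m :
  (1 < #|X|)%N -> iso_twisted_orbit x op n ->
  (forall p, x p = m * p * m^-1) -> n <> m^-1.
Proof.
move=> /card_gt1P[i [j [_ _ /eqP ij]]] [f [injf imf _]] xE nE; apply: ij.
have fE k : f k = n.
  have /imsetP[u _ ->] : f k \in twisted_orbit x n by rewrite -imf imset_f.
  by rewrite /twisted_act xE nE !mulgA mulgKV mulgV mul1g.
by apply: injf; rewrite !fE.
Qed.

(** Both realizations identify N with the derived subgroup of the inner group of
X. The comparison of the two identifications is an automorphism a of N which, by
[twisted_permJ], carries conj_(f i) o x to conj_(f' i) o x'. *)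
Lemma twisted_orbits_conj (X : finType) (op : X -> X -> X) (hR : is_rack op)
    (x x' : {perm N}) n n' :
  (1 < #|X|)%N -> ~~ abelian [set: N] ->
  x \in Aut [set: N] -> x' \in Aut [set: N] ->
  no_stable_normal x ->
  no_stable_normal x' ->
  iso_twisted_orbit x op n -> iso_twisted_orbit x' op n' -> conj_in_Out x x'.
Proof.
move=> gt1X nabN Ax Ax' minx minx' [f [injf imf fM]] [f' [injf' imf' fM']].
have [i [_ _]] := card_gt1P gt1X.
have injR := injm_twisted_perm hR Ax injf imf fM gt1X minx.
have injR' := injm_twisted_perm hR Ax' injf' imf' fM' gt1X minx'.
have imR := twisted_perm_der hR Ax injf imf fM gt1X nabN minx.
have imR' := twisted_perm_der hR Ax' injf' imf' fM' gt1X nabN minx'.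
have exa m : exists p, twisted_perm Ax' injf' imf' p == twisted_perm Ax injf imf m.
  have : twisted_perm Ax injf imf m \in (rack_inn hR)^`(1).
    by rewrite imR mem_morphim ?inE.
  by rewrite imR' => /morphimP[p _ _ ->]; exists p.
pose a0 m := xchoose (exa m).
have a0E m : twisted_perm Ax' injf' imf' (a0 m) = twisted_perm Ax injf imf m.
  exact/eqP/(xchooseP (exa m)).
have inj_a0 : injective a0.
  move=> p q pq; apply: (injmP injR); rewrite ?inE //=.
  by rewrite -!a0E pq.
pose a := perm inj_a0.
have aE m : twisted_perm Ax' injf' imf' (a m) = twisted_perm Ax injf imf m.
  by rewrite permE a0E.
have aM : {morph a : p q / p * q}.
  move=> p q; apply: (injmP injR'); rewrite ?inE //=.
  by rewrite aE !(twisted_permM, inE) ?inE // !aE.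
have Aa : a \in Aut [set: N].
  rewrite inE; apply/andP; split; first by apply/subsetP=> p; rewrite !inE.
  by apply/morphicP=> p q _ _; apply: aM.
have conjE m : a (f i * x m * (f i)^-1) = f' i * x' (a m) * (f' i)^-1.
  apply: (injmP injR'); rewrite ?inE //= aE -!(twisted_permJ hR) //.
  by rewrite aE.
have Axa : x ^ a \in Aut [set: N] by rewrite groupJ.
apply/conj_in_OutP=> //; exists a => //.
(* The relation conjE yields the inner factor (a (f i))^-1 * f' i on the other
   side of x ^ a; commuting it past x ^ a applies the inverse of x ^ a to it. *)
exists ((x ^ a)^-1%g ((a (f i))^-1 * f' i)).
rewrite conjgC (conj_autJ _ Axa) permKV; apply/permP=> p.
rewrite permM conj_autE ?inE // -(permKV a p); set q := a^-1%g p.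
have -> : (x ^ a) (a q) = a (x q) by rewrite conjgE !permM permK.
have <- : (f' i)^-1 * a (f i * x q * (f i)^-1) * f' i = x' (a q).
  by rewrite conjE !mulgA mulVg mul1g mulgKV.
by rewrite !aM (AutV Aa) conjgE invMg invgK !mulgA.
Qed.

End OuterClasses.

(** * Cyclically permuted minimal normal subgroups *)

Lemma prodgM_distinct_commute (gT : finGroupType) (I : eqType) (r : seq I)
    (F H : I -> gT) :
  uniq r -> (forall i j, i != j -> commute (F i) (H j)) ->
  \prod_(i <- r) (F i * H i) = \prod_(i <- r) F i * \prod_(i <- r) H i.
Proof.
move=> + cFH; elim: r => [|i r IH] /=; first by rewrite !big_nil mulg1.
case/andP=> ir /IH{}IH; rewrite !big_cons IH -!mulgA; congr (_ * _).
rewrite !mulgA; congr (_ * _); rewrite big_seq.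
apply: commute_prod => j jr; apply/commute_sym/cFH.
by apply: contraNneq ir => <-.
Qed.

Lemma minnormalJ (gT : finGroupType) (S G : {group gT}) a :
  a \in 'N(G) -> S \subset G -> minnormal S G -> minnormal (S :^ a) G.
Proof.
move=> nGa sSG; rewrite -(injm_minnormal (injm_conj G a)) // !morphim_conj.
by rewrite (setIidPr sSG) setIid (normP nGa).
Qed.

(** The commutator subgroup lies in the intersection, which is normal in G and
therefore trivial. *)
Lemma minnormal_cent (gT : finGroupType) (A B G : {group gT}) :
  minnormal A G -> minnormal B G -> A \subset G -> B \subset G ->
  A != B :> {set gT} -> A \subset 'C(B).
Proof.
case/mingroupP=> /andP[_ nAG] minA /mingroupP[/andP[_ nBG] minB] sAG sBG neqAB.
have nABG : G \subset 'N(A :&: B) by rewrite normsI.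
apply/commG1P/trivgP; apply: subset_trans (commg_subI (G := A) (H := B) _ _) _.
- by rewrite subsetI subxx (subset_trans sAG).
- by rewrite subsetI subxx (subset_trans sBG).
apply: contraR neqAB; rewrite subG1 => ntAB.
rewrite -{1}(minA (A :&: B)%G) ?subsetIl ?ntAB //=.
by rewrite -{2}(minB (A :&: B)%G) ?subsetIr ?ntAB.
Qed.

(** Here S is a minimal normal subgroup of N and t + 1 the least positive exponent
k for which y^k normalizes S. The conjugates of S by y^0, ..., y^t are called
blocks; they are distinct, hence commute pairwise. *)
Section CyclicMinimalNormal.

Variables (gT : finGroupType) (N : {group gT}) (y : gT).
Hypotheses (nNy : y \in 'N(N)) (minN : minnormal N (N <*> <[y]>)).
Hypothesis nabN : ~~ abelian N.

Variables (S : {group gT}) (t : nat).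
Hypotheses (minS : minnormal S N) (sSN : S \subset N).
Hypotheses (St : S :^ (y ^+ t.+1) = S).
Hypothesis tmin : forall k, (0 < k)%N -> S :^ (y ^+ k) = S -> (t < k)%N.

Local Notation L := (subg_of S).
Local Notation Npow := (dpower L t.+1).
Local Notation at0 := (@dfung1 _ (fun _ : 'I_t.+1 => L) ord0).

Lemma minN_full (H : {group gT}) :
  H != 1 :> {set gT} -> H \subset N -> N \subset 'N(H) -> y \in 'N(H) ->
  H :=: N.
Proof.
case/mingroupP: minN => _ min ntH sHN nHN nHy; apply: min => //.
by rewrite ntH join_subG nHN cycle_subG.
Qed.

Lemma block_sub i : S :^ (y ^+ i) \subset N.
Proof. by rewrite -(normP (groupX i nNy)) conjSg. Qed.

Lemma block_min i : minnormal (S :^ (y ^+ i)) N.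
Proof. by apply: minnormalJ; rewrite ?groupX. Qed.

Lemma block_cent i j : (i < t.+1)%N -> (j < t.+1)%N -> i != j ->
  S :^ (y ^+ i) \subset 'C(S :^ (y ^+ j)).
Proof.
move=> ti tj ij; have := minnormal_cent (A := (S :^ (y ^+ i))%G)
  (B := (S :^ (y ^+ j))%G) (block_min i) (block_min j) (block_sub i)
  (block_sub j); apply.
have neq k l : (k < l)%N -> (l < t.+1)%N -> S :^ (y ^+ k) != S :^ (y ^+ l).
  move=> kl lt; apply/eqP => E.
  have /tmin : S :^ (y ^+ (l - k)) = S.
    by apply: (can_inj (conjsgK (y ^+ k))); rewrite -conjsgM -expgD subnK ?E // ltnW.
  by rewrite subn_gt0 kl => /(_ isT); rewrite ltnNge (leq_trans (leq_subr _ _)).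
by move: ij; rewrite neq_ltn => /orP[] /neq; [|rewrite eq_sym]; apply.
Qed.

Definition blocks_prod (l : Npow) : gT :=
  \prod_(i < t.+1) (sgval (l i)) ^ (y ^+ i).

Lemma mem_block (s : L) i : sgval s ^ (y ^+ i) \in S :^ (y ^+ i).
Proof. by rewrite memJ_conjg subgP. Qed.

Lemma block_commute (s u : L) i j : (i < t.+1)%N -> (j < t.+1)%N -> i != j ->
  commute (sgval s ^ (y ^+ i)) (sgval u ^ (y ^+ j)).
Proof.
move=> ti tj ij.
by apply: (centsP (block_cent ti tj ij)); apply: mem_block.
Qed.

Lemma blocks_prodM : {in [set: Npow] &, {morph blocks_prod : a b / a * b}}.
Proof.
move=> a b _ _; rewrite /blocks_prod.
under eq_bigr => i _ do rewrite mulg_ffun sgvalM ?inE // conjMg.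
rewrite prodgM_distinct_commute ?index_enum_uniq // => i j ij.
exact: block_commute.
Qed.
Canonical blocks_prod_morphism := Morphism blocks_prodM.

Lemma blocks_prod1 (s : L) : blocks_prod (at0 s) = sgval s.
Proof.
rewrite /blocks_prod big_ord_recl dfung1_id expg0 conjg1 big1 ?mulg1 //.
by move=> i _; rewrite dfung1_dflt // conj1g.
Qed.

Fact return_subproof (s : L) : sgval s ^ (y ^+ t.+1) \in S.
Proof. by rewrite -St memJ_conjg subgP. Qed.

(** The automorphism theta of the twisted shift: what conjugation by y induces on
S after a full turn through the blocks. *)
Definition return_fun (s : L) : L := subg S (sgval s ^ (y ^+ t.+1)).

Lemma return_funE s : sgval (return_fun s) = sgval s ^ (y ^+ t.+1).
Proof. exact: subgK (return_subproof s). Qed.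

Lemma return_fun_inj : injective return_fun.
Proof.
by move=> s u /(congr1 sgval); rewrite !return_funE => /conjg_inj/val_inj.
Qed.

Definition return_perm : {perm L} := perm return_fun_inj.

Lemma return_perm_Aut : return_perm \in Aut [set: L].
Proof.
rewrite inE; apply/andP; split; first by apply/subsetP=> p; rewrite !inE.
apply/morphicP=> p q _ _; rewrite !permE; apply: val_inj => /=.
by rewrite !return_funE -conjMg.
Qed.

(** Conjugation by y sends the i-th block to the next one, and the last one back
to S through the return automorphism. The element so returned to S stands last in
the product and has to be commuted past the other blocks. *)
Lemma blocks_prod_shift (x : {perm Npow}) l :
  shift_by return_perm x -> blocks_prod (x l) = blocks_prod l ^ y.
Proof.
move=> sx; rewrite /blocks_prod conjg_prod big_ord_recl big_ord_recr /=.
have xS (i : 'I_t) : x l (lift ord0 i) = l (widen_ord (leqnSn t) i).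
  rewrite sx /=; congr (l _); apply: val_inj => /=.
  by rewrite add0n modnDr modn_small // ltnS ltnW.
have x0 : x l ord0 = return_perm (l ord_max).
  rewrite sx /=; congr (return_perm (l _)); apply: val_inj => /=.
  by rewrite modn_small.
rewrite x0 permE expg0 conjg1 return_funE -conjgM -expgSr.
under eq_bigr => i _ do rewrite xS.
under [X in _ = X * _]eq_bigr => i _ do rewrite -conjgM -expgSr.
apply: commute_prod => i _; rewrite -return_funE -[sgval _]conjg1 -(expg0 y).
by apply: block_commute; rewrite //= ltnS.
Qed.

Lemma im_blocks_prod_sub : blocks_prod @* [set: Npow] \subset N.
Proof.
apply/subsetP=> _ /morphimP[l _ _ ->]; apply: group_prod => i _.
exact: subsetP (block_sub i) _ (mem_block _ _).
Qed.

(** The product of the blocks is nontrivial and normalized by N and by y. *)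
Lemma im_blocks_prod : blocks_prod @* [set: Npow] = N.
Proof.
have ntS : S != 1 :> {set gT} by have [/andP[]] := mingroupP minS.
have [x _ sx] := shift_perm_exists t.+1 return_perm_Aut.
apply: (minN_full (H := (blocks_prod @* [set: Npow])%G)).
- case/trivgPn: ntS => s sS s1; apply/trivgPn; exists s => //=.
  apply/morphimP; exists (at0 (subg S s)).
  + by rewrite inE.
  + by rewrite inE.
  by rewrite /= blocks_prod1 subgK.
- exact: im_blocks_prod_sub.
- apply/subsetP=> g gN; rewrite inE.
  apply/subsetP=> _ /imsetP[_ /morphimP[l _ _ ->] ->] /=.
  pose l' : Npow :=
    [ffun i : 'I_t.+1 => subg S (((sgval (l i) ^ (y ^+ i)) ^ g) ^ (y ^- i))].
  apply/morphimP; exists l'; rewrite ?inE //= /blocks_prod conjg_prod.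
  apply: eq_bigr => i _; rewrite ffunE subgK ?conjgKV //.
  rewrite -mem_conjgV invgK memJ_norm ?mem_block //.
  by have /mingroupP[/andP[_ /subsetP->]] := block_min i.
rewrite inE; apply/subsetP=> _ /imsetP[_ /morphimP[l _ _ ->] ->] /=.
by rewrite -(blocks_prod_shift l sx) mem_morphim ?inE.
Qed.

Lemma block_nonabelian : ~~ abelian S.
Proof.
apply: contra nabN => abS; rewrite -im_blocks_prod morphim_abelian //.
apply/centsP => a _ b _; apply/ffunP => i; rewrite !mulg_ffun.
by apply: val_inj; apply: (centsP abS); apply: subgP.
Qed.

(** The other blocks centralize S, so a normal subgroup of S is normal in N. *)
Lemma block_simple : simple S.
Proof.
have /mingroupP[/andP[ntS _] min] := minS.
apply/simpleP; split=> // H nHS; have [sHS nH] := andP nHS.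
have [H1|ntH] := eqVneq (H : {set gT}) 1; first by left.
right; apply: min => //; rewrite ntH -im_blocks_prod.
apply/subsetP=> _ /morphimP[l _ _ ->] /=; apply: group_prod => i _.
have [i0|i0] := eqVneq (val i) 0%N.
  by rewrite i0 expg0 conjg1 (subsetP nH) // subgP.
have := block_cent (ltn_ord i) (ltn0Sn t) i0; rewrite expg0 conjsg1 => cS.
rewrite (subsetP (cent_sub _)) // (subsetP (centS sHS)) // (subsetP cS) //.
exact: mem_block.
Qed.

Lemma simple_block : simple [set: L].
Proof. by rewrite -(isog_simple (isog_subg S)) block_simple. Qed.

Lemma nonabelian_block : ~~ abelian [set: L].
Proof. by rewrite -(isog_abelian (isog_subg S)) block_nonabelian. Qed.

(** The kernel is stable under the twisted shift that corresponds to conjugation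
by y, hence is trivial or everything, and N is not trivial. *)
Lemma injm_blocks_prod : 'injm blocks_prod.
Proof.
have [x _ sx] := shift_perm_exists t.+1 return_perm_Aut.
have [|K1|KT] := shift_no_stable_normal simple_block nonabelian_block
  return_perm_Aut sx (ker_normal blocks_prod_morphism).
- move=> m /mker/= km; apply/kerP; rewrite ?inE //=.
  by rewrite (blocks_prod_shift m sx) km conj1g.
- by rewrite K1.
case/negP: nabN; apply: abelianS (abelian1 _); rewrite -im_blocks_prod.
apply/subsetP=> _ /morphimP[l lT _ ->]; apply/set1gP/mker.
by rewrite KT.
Qed.

End CyclicMinimalNormal.

Lemma minnormal_dpower (gT : finGroupType) (N : {group gT}) y :
  y \in 'N(N) -> minnormal N (N <*> <[y]>) -> ~~ abelian N ->
  exists (L : finGroupType) (t : nat) (theta : {perm L}) (x : {perm dpower L t})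
    (F : {morphism [set: dpower L t] >-> gT}),
  [/\ simple [set: L], ~~ abelian [set: L] & (0 < t)%N] /\
  [/\ theta \in Aut [set: L], x \in Aut [set: dpower L t] & shift_by theta x] /\
  [/\ 'injm F, F @* [set: dpower L t] = N & forall l, F (x l) = F l ^ y].
Proof.
move=> nNy minN nabN; have [/andP[ntN _] _] := mingroupP minN.
have [S minS sSN] := minnormal_exists ntN (normG N).
have ext : exists k, (0 < k)%N && (S :^ (y ^+ k) == S :> {set gT}).
  by exists #[y]; rewrite order_gt0 expg_order conjsg1 eqxx.
have [[//|t] /andP[_ /eqP St] tmin] := ex_minnP ext.
have tmin' k : (0 < k)%N -> S :^ (y ^+ k) = S -> (t < k)%N.
  by move=> k0 Sk; apply: tmin; rewrite k0 Sk eqxx.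
have Ath := return_perm_Aut St.
have [x Ax sx] := shift_perm_exists t.+1 Ath.
exists (subg_of S : finGroupType), t.+1, (return_perm St), x.
exists (blocks_prod_morphism nNy minS sSN tmin'); split; [|split]; split=> //.
- exact: (simple_block nNy minN minS sSN St tmin').
- exact: (nonabelian_block nNy minN nabN minS sSN St tmin').
- exact: (injm_blocks_prod nNy minN nabN minS sSN St tmin').
- exact: (im_blocks_prod nNy minN minS sSN St tmin').
by move=> l; apply: (blocks_prod_shift nNy minS sSN tmin' l sx).
Qed.

(** * Simple racks *)

Section SimpleCrossedSet.

Variables (X : finType) (op : X -> X -> X).
Hypotheses (hR : is_rack op) (opid : forall i, op i i = i).
Hypothesis simX : is_simple_rack op.

Local Notation phi := (rack_perm hR).
Local Notation G := (rack_inn hR).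
Local Notation N := (G^`(1)).

(** A congruence, here presented as the kernel of k, gives a quotient rack on the
image of k. Its translations are bijective because they are onto and the image
is finite. *)
Lemma simple_rack_congruence (T : finType) (k : X -> T) :
  (forall i i' j j', k i = k i' -> k j = k j' -> k (op i j) = k (op i' j')) ->
  (forall i j, k i = k j) \/ injective k.
Proof.
move=> kM; have [_ _ simq] := simX.
pose Y : finType := {y : T | y \in codom k}.
pose q i : Y := exist _ (k i) (codom_f k i).
have exr (y : Y) : exists i, q i == y.
  by have /codomP[i yi] := valP y; exists i; apply/eqP/val_inj.
pose r y := xchoose (exr y).
have rK : cancel r q by move=> y; apply/eqP/(xchooseP (exr y)).
have krq i : k (r (q i)) = k i by apply: (congr1 val (rK (q i))).
pose opY y z := q (op (r y) (r z)).
have qM : rack_morphism op opY q.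
  by move=> i j; apply: val_inj; apply: kM; rewrite krq.
have rackY : is_rack opY.
  split=> [|y|y z w]; first by have [i] := rack_nonempty hR; split; apply: q i.
    have gK : cancel (fun z => q ((phi (r y))^-1%g (r z))) (opY y).
      by move=> z; rewrite -{1}[y]rK -qM -(rack_permE hR) permKV rK.
    have bg := injF_bij (can_inj gK).
    exact: (bij_can_bij bg gK).
  by rewrite -[y]rK -[z]rK -[w]rK -!qM (rack_selfdistr hR).
have [| Y1 | YX] := simq _ opY q rackY qM.
- by move=> y; exists (r y); apply: rK.
- have /fintype_le1P Y1' : (#|Y| <= 1)%N by rewrite Y1.
  by left=> i j; apply: (congr1 val (Y1' (q j) (q i))).
right=> i j kij; apply: (bij_inj (bij_can_bij _ rK)); last exact: val_inj.
by apply: inj_card_bij (can_inj rK) _; rewrite YX.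
Qed.

Lemma simple_rack_perm_inj : injective phi.
Proof.
have [i i' j j' pi pj|phic|//] := simple_rack_congruence (k := phi).
  by rewrite !rack_perm_op pi pj.
have [_ ntriv _] := simX; case: ntriv => i j.
by rewrite -(rack_permE hR) (phic i j) rack_permE opid.
Qed.

(** Reduction of the translations mod H is a congruence. If it separated points,
any h in H would fix every i, since phi_(h i) = phi_i ^ h has the same class as
phi_i. *)
Lemma simple_rack_coset (H : {group {perm X}}) :
  H <| G -> H != 1 :> {set {perm X}} -> forall i j, (phi i)^-1 * phi j \in H.
Proof.
move=> /andP[sHG nHG] /trivgPn[h hH h1].
have nphi i : phi i \in 'N(H) by rewrite (subsetP nHG) // mem_rack_inn.
have [i i' j j' pi pj|phic|injH] :=
    simple_rack_congruence (k := fun i => coset H (phi i)).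
- by rewrite !rack_perm_op !morphJ //= pi pj.
- move=> i j; apply: coset_idr; first by rewrite groupM ?groupV.
  by rewrite morphM ?groupV //= morphV //= (phic i j) mulVg.
case/eqP: h1; apply/permP=> i; rewrite perm1; apply: injH.
rewrite (rack_permJ hR); last exact: rack_inn_morphism (subsetP sHG _ hH).
by rewrite morphJ ?(subsetP (normG H) h hH) //= (coset_id hH) conjg1.
Qed.

Lemma simple_rack_der_min (H : {group {perm X}}) :
  H <| G -> H != 1 :> {set {perm X}} -> N \subset H.
Proof.
move=> nHG ntH; have [i] := rack_nonempty hR.
apply: (rack_inn_der_sub (i := i)) => k.
  by rewrite (subsetP (normal_norm nHG)) // mem_rack_inn.
exact: simple_rack_coset.
Qed.

Lemma simple_rack_der_neq1 : N != 1.
Proof.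
apply/eqP=> /derG1P abG; have [_ ntriv _] := simX; case: ntriv => i j.
apply: simple_rack_perm_inj; rewrite rack_perm_op conjgE.
by rewrite (centsP abG _ (mem_rack_inn hR j) _ (mem_rack_inn hR i)) mulKg.
Qed.

(** Equality of N-orbits is a congruence because all the translations agree
modulo N; it does not separate points since N is not trivial. *)
Lemma simple_rack_der_trans i j : exists2 m, m \in N & m i = j.
Proof.
have nNG : N <| G := der_normal 1 G.
have nNphi l : phi l \in 'N(N).
  by rewrite (subsetP (normal_norm nNG)) // mem_rack_inn.
have [a a' b b'|orbc|orbi] := simple_rack_congruence (k := orbit 'P N).
- move=> _ /orbit_eqP/orbitP[m mN /= mb]; apply/orbit_eqP/orbitP.
  exists (m ^ phi a' * ((phi a')^-1 * phi a)) => /=.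
    by rewrite groupM ?memJ_norm // simple_rack_coset // simple_rack_der_neq1.
  rewrite /aperm -mb /= /aperm -!(rack_permE hR) -!permM.
  by rewrite mulgA -conjgC -mulgA mulKVg.
- have /orbitP[m mN mi] : j \in orbit 'P N i by rewrite (orbc i j) orbit_refl.
  by exists m.
case/trivgPn: simple_rack_der_neq1 => m mN /eqP[]; apply/permP=> l.
rewrite perm1; apply: orbi; apply/orbit_eqP/orbitP; by exists m.
Qed.

(** An abelian minimal normal subgroup is an r-group for a prime r, and |X|
divides |N| by transitivity. *)
Lemma simple_rack_der_nonabelian p q :
  prime p -> prime q -> p != q -> (p %| #|X|)%N -> (q %| #|X|)%N -> ~~ abelian N.
Proof.
move=> pr_p pr_q neq_pq pX qX; apply/negP=> abN.
have minN : minnormal N G.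
  apply/mingroupP; rewrite simple_rack_der_neq1 normal_norm ?der_normal //=.
  split=> // H /andP[ntH nHG] sHN; apply/eqP; rewrite eqEsubset sHN /=.
  by apply: simple_rack_der_min; rewrite // /normal nHG (subset_trans sHN) ?der_sub.
have [_ _ /is_abelemP[r _ /abelem_pgroup/pgroupP rN]] :=
  minnormal_solvable minN (subxx _) (abelian_sol abN).
have [i] := rack_nonempty hR.
have XN : (#|X| %| #|N|)%N.
  have -> : #|X| = #|orbit 'P N i|; last exact: dvdn_orbit.
  apply: eq_card => j; rewrite !inE; apply/esym/orbitP.
  by have [m mN mi] := simple_rack_der_trans i j; exists m.
have /eqP pr : p == r by apply: rN (dvdn_trans pX XN).
have /eqP qr : q == r by apply: rN (dvdn_trans qX XN).
by rewrite pr qr eqxx in neq_pq.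
Qed.

(** Identify N = G' with L^t so that conjugation by y = phi_(i0) becomes x. As all
the translations lie in y N, i |-> phi_i^-1 * y embeds X in N. If g in N moves i0
to i then phi_i = y ^ g, and phi_i^-1 * y = g^-1 * (g ^ y) is the image of 1 under
the twisted action of g^-1. *)
Lemma simple_rack_realized :
  (1 < #|X|)%N -> ~~ abelian N ->
  exists (L : finGroupType) (t : nat) (x : {perm dpower L t}) (n : dpower L t),
    realizes op x n.
Proof.
move=> gt1X nabN; have [i0] := rack_nonempty hR; set y := phi i0.
have nNG : N <| G := der_normal 1 G.
have NE i j : (phi i)^-1 * phi j \in N.
  exact: simple_rack_coset nNG simple_rack_der_neq1 i j.
have sG : G \subset N <*> <[y]>.
  apply: rack_innP => k; rewrite -(mulKVg y (phi k)).
  apply: groupM; first by rewrite (subsetP (joing_subr _ _)) ?cycle_id.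
  by rewrite (subsetP (joing_subl _ _)) //; apply: NE.
have nNy : y \in 'N(N) by rewrite (subsetP (normal_norm nNG)) // mem_rack_inn.
have minN : minnormal N (N <*> <[y]>).
  apply/mingroupP; rewrite simple_rack_der_neq1 join_subG normG cycle_subG /= nNy.
  split=> // H /andP[ntH nH] sHN; apply/eqP; rewrite eqEsubset sHN /=.
  apply: simple_rack_der_min => //.
  by rewrite /normal (subset_trans sHN) ?der_sub // (subset_trans sG).
have [L [t [theta [x [F [[simL nabL t0] [[Ath Ax sx] [injF imF Fx]]]]]]]] :=
  minnormal_dpower nNy minN nabN.
have exf i : exists l, F l == (phi i)^-1 * y.
  have : (phi i)^-1 * y \in N by apply: NE.
  by rewrite -imF => /morphimP[l _ _ ->]; exists l.
pose f i := xchoose (exf i).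
have fE i : F (f i) = (phi i)^-1 * y by apply/eqP/(xchooseP (exf i)).
have FI l l' : F l = F l' -> l = l' by apply: (injmP injF); rewrite inE.
have FM l l' : F (l * l') = F l * F l' by rewrite morphM ?inE.
have FV l : F l^-1 = (F l)^-1 by rewrite morphV ?inE.
have isoX : iso_twisted_orbit x op 1.
  exists f; split=> [i j fij||i j].
  - by apply/simple_rack_perm_inj/invg_inj/(mulIg y); rewrite -!fE fij.
  - apply/setP=> l; apply/imsetP/imsetP=> [[i _ ->]|[m _ ->]].
      have [g gN gi] := simple_rack_der_trans i0 i.
      have [m _ mE] : exists2 m, m \in [set: dpower L t] & F m = g^-1.
        have : g^-1 \in N by rewrite groupV.
        by rewrite -imF => /morphimP[m _ _ ->]; exists m.
      exists m => //; apply: FI; rewrite fE /twisted_act mulg1 FM Fx FV mE.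
      rewrite -gi rack_permJ; last exact: rack_inn_morphism (subsetP (der_sub 1 G) g gN).
      by rewrite -/y !conjgE !invMg !invgK !mulgA.
    have FmN : F m \in N by rewrite -imF mem_morphim ?inE.
    exists ((F m)^-1%g i0) => //; apply: FI.
    rewrite fE /twisted_act mulg1 FM Fx FV rack_permJ.
      by rewrite -/y !conjgE !invMg !invgK !mulgA.
    by apply: rack_inn_morphism; rewrite groupV (subsetP (der_sub 1 G)).
  apply: FI; rewrite /twisted_op FM Fx FM FV !fE rack_perm_op.
  by rewrite !conjgE !invMg !invgK !mulgA !mulgK.
exists L, t, x, 1; split=> //; first by split=> //; exists theta.
by move=> _ m; apply: inner_twisted_orbit isoX.
Qed.

End SimpleCrossedSet.

(** * The classification *)

Theorem theorem3p12 (X : finType) (op : X -> X -> X) (hX : is_crossed_set op)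
    (hprimes : exists p q : nat,
       [/\ prime p, prime q, p != q, (p %| #|X|)%N & (q %| #|X|)%N]) :
  (is_simple_rack op <->
     exists (L : finGroupType) (t : nat) (x : {perm dpower L t})
       (n : dpower L t), realizes op x n) /\
  (forall (L : finGroupType) (t : nat) (x : {perm dpower L t})
     (n : dpower L t), realizes op x n ->
     (forall (L' : finGroupType) (t' : nat) (x' : {perm dpower L' t'})
        (n' : dpower L' t'), realizes op x' n' ->
        [set: L] \isog [set: L'] /\ t = t') /\
     (forall x' : {perm dpower L t}, is_twisted_shift x' ->
        ((exists n' : dpower L t, realizes op x' n') <-> conj_in_Out x x'))).
Proof.
have [p [q [pr_p pr_q neq_pq pX qX]]] := hprimes.
have hR := crossed_set_rack hX.
(* A rack is nonempty, so divisibility by a prime excludes a single point. *)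
have gt1X : (1 < #|X|)%N.
  have [i] := rack_nonempty hR; have X0 : (0 < #|X|)%N by apply/card_gt0P; exists i.
  exact: leq_trans (prime_gt1 pr_p) (dvdn_leq X0 pX).
have minN (L : finGroupType) t (x : {perm dpower L t}) :
    simple [set: L] -> ~~ abelian [set: L] -> is_twisted_shift x ->
    no_stable_normal x.
  by move=> simL nabL [_ [theta Ath sx]]; apply: shift_no_stable_normal sx.
have isoder (L : finGroupType) t (x : {perm dpower L t}) n :
    realizes op x n -> [set: dpower L t] \isog (rack_inn hR)^`(1).
  case=> simL nabL t0 sx [f [injf imf fM]] _.
  exact: (twisted_isog_der hR sx.1 injf imf fM gt1X (dpower_nonabelian nabL t0)
    (minN _ _ _ simL nabL sx)).
split; [split|] => [simX|[L [t [x [n]]]]|L t x n real].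
- have nabD := simple_rack_der_nonabelian hR (crossed_set_idem hX) simX
    pr_p pr_q neq_pq pX qX.
  exact: (simple_rack_realized (crossed_set_idem hX) simX gt1X nabD).
- case=> simL nabL t0 sx [f [injf imf fM]] _.
  exact: (twisted_realization_simple hR sx.1 injf imf fM gt1X
    (dpower_nonabelian nabL t0) (minN _ _ _ simL nabL sx)).
have [simL nabL t0 sx isoX _] := real; split=> [L' t' x' n' real' | x' sx'].
  have [simL' nabL' _ _ _ _] := real'.
  apply: dpower_isog_inj => //.
  by apply: isog_trans (isoder _ _ _ _ real) _; rewrite isog_sym (isoder _ _ _ _ real').
split=> [[n' [_ _ _ _ isoX' _]] | cxx'].
  exact: (twisted_orbits_conj hR gt1X (dpower_nonabelian nabL t0) sx.1 sx'.1
    (minN _ _ _ simL nabL sx) (minN _ _ _ simL nabL sx') isoX isoX').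
have [n' isoX'] := iso_twisted_orbit_conj sx.1 sx'.1 cxx' isoX.
exists n'; split=> // _ m; exact: inner_twisted_orbit isoX'.
Qed.
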